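(* Let $\mu,\nu,P_f^0,P_f^1,P_m^0,P_m^1\in(0,1)$, and let $\mathbf p=(P_0,P_1,P_2,P_3)^{\mathbf T}$ be the steady-state probability vector ($\mathbf\Psi\mathbf p=\mathbf p$, $\sum_{k=0}^3P_k=1$) of the four-state system Markov chain with transition matrix $\mathbf\Psi$ given in the context. Put $\xi=1-P_f^0+P_f^1$, $\zeta=1+P_m^0-P_m^1$, $r=\nu/\mu$, $\Delta=1+r-1/\mu$, and $P_{busy}=P_1+P_3$. Then the overall collision ratio $$P_c=\frac{P_3+\frac12\,\frac{\mu\nu}{\mu+\nu}}{P_{busy}}$$ equals $$P_c=\frac{\nu}{2}+\frac{P_m^0\left(1-\xi\Delta\right)+\left(1-P_f^0\right)r}{\left(1-\xi\Delta\right)\zeta+\xi r}.$$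
   Context: Model: time is slotted. A primary user (PU) is either idle or busy; if idle it becomes busy in a slot with probability $\mu$, if busy it becomes idle with probability $\nu$. A secondary user (SU) is either silent or transmitting; at the end of each slot it senses the channel, transmits in the next slot if it judges the PU absent, and stays silent otherwise. $P_f^0,P_m^0$ are the false-alarm and miss-detection probabilities of sensing when the SU is silent, and $P_f^1,P_m^1$ those when the SU is transmitting. The system states are $S_0$ (PU idle, SU silent: spectrum waste), $S_1$ (PU busy, SU silent), $S_2$ (PU idle, SU transmitting), $S_3$ (PU busy, SU transmitting: collision). With $\mathbf\Psi_{ij}$ denoting the probability of moving from $S_j$ to $S_i$ ($i,j=0,1,2,3$), $$\mathbf\Psi=\begin{pmatrix} P_f^0(1-\mu)&(1-P_m^0)\nu&P_f^1(1-\mu)&(1-P_m^1)\nu\\ P_f^0\mu&(1-P_m^0)(1-\nu)&P_f^1\mu&(1-P_m^1)(1-\nu)\\ (1-P_f^0)(1-\mu)&P_m^0\nu&(1-P_f^1)(1-\mu)&P_m^1\nu\\ (1-P_f^0)\mu&P_m^0(1-\nu)&(1-P_f^1)\mu&P_m^1(1-\nu) \end{pmatrix}.$$ The overall collision ratio combines collisions of full slot length (probability $P_3$) and collisions of average length half a slot in slots where the PU arrives (occurrence probability $\frac{\mu\nu}{\mu+\nu}$), normalized by the probability $P_{busy}$ that the PU is busy. *)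

(* Defs.v *)
From HB Require Import structures.
From mathcomp Require Import all_boot all_order all_algebra.
Set Implicit Arguments.
Unset Strict Implicit.
Unset Printing Implicit Defensive.
Import Order.TTheory GRing.Theory Num.Theory.
Local Open Scope ring_scope.

(* Joint states of the primary user (PU) and the secondary user (SU):
     S0 : PU idle, SU silent (waste)    S1 : PU busy, SU silent
     S2 : PU idle, SU transmitting      S3 : PU busy, SU transmitting
                                             (collision)                   *)
Definition S0 : 'I_4 := @Ordinal 4 0 isT.
Definition S1 : 'I_4 := @Ordinal 4 1 isT.
Definition S2 : 'I_4 := @Ordinal 4 2 isT.
Definition S3 : 'I_4 := @Ordinal 4 3 isT.

(* Entry (i, j) is the probability of moving from S_j to S_i, so columns (not
   rows) sum to 1 and distributions are column vectors.  Superscripts 0 and 1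
   on Pf (false alarm) and Pm (miss detection) become suffixes. *)
Definition Psi (R : pzRingType) (mu nu Pf0 Pf1 Pm0 Pm1 : R) : 'M[R]_4 :=
  \matrix_(i < 4, j < 4) (nth [::]
    [:: [:: Pf0 * (1 - mu);       (1 - Pm0) * nu;
            Pf1 * (1 - mu);       (1 - Pm1) * nu];
        [:: Pf0 * mu;             (1 - Pm0) * (1 - nu);
            Pf1 * mu;             (1 - Pm1) * (1 - nu)];
        [:: (1 - Pf0) * (1 - mu); Pm0 * nu;
            (1 - Pf1) * (1 - mu); Pm1 * nu];
        [:: (1 - Pf0) * mu;       Pm0 * (1 - nu);
            (1 - Pf1) * mu;       Pm1 * (1 - nu)]] i)`_j.

Definition steady_state (R : pzRingType) (n : nat)
    (A : 'M[R]_n) (p : 'cV[R]_n) : Prop :=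
  A *m p = p /\ \sum_(k < n) p k 0 = 1.

Definition Pbusy (R : nmodType) (p : 'cV[R]_4) : R := p S1 0 + p S3 0.

(* Full-slot collisions have probability p S3 0; in the slots where the PU
   arrives, which occur with probability mu * nu / (mu + nu), a collision
   lasts half a slot on average. *)
Definition collision_ratio (R : fieldType) (mu nu : R) (p : 'cV[R]_4) : R :=
  (p S3 0 + 1 / 2 * (mu * nu / (mu + nu))) / Pbusy p.

(* Main.v *)
Require Import Defs.
From HB Require Import structures.
From mathcomp Require Import all_boot all_order all_algebra.
From mathcomp Require Import ring lra.
Import Order.TTheory GRing.Theory Num.Theory.
Local Open Scope ring_scope.

(** Summing the balance equations over the state of the SU shows that the PU
    alone is a two-state chain, so [mu * (P0 + P2) = nu * (P1 + P3)].  Let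
    [F = (1 - Pf0) (P0 + P2) + (1 - xi) P2] and
    [G = Pm0 (P1 + P3) + (1 - zeta) P3] be the probabilities that the channel
    is judged free while idle, respectively while busy; then
    [P2 = (1 - mu) F + nu G] and [P3 = mu F + (1 - nu) G].  Eliminating [P2]
    gives [D * P3 = (1 - Pf0) (P0 + P2) + Pm0 (1 - xi Delta) (P1 + P3)], where
    [D] is the denominator in the formula; dividing by [P1 + P3] yields it. *)

Lemma sum_ord4 (V : nmodType) (f : 'I_4 -> V) :
  \sum_(k < 4) f k = f S0 + f S1 + f S2 + f S3.
Proof.
rewrite !big_ord_recr big_ord0 /= add0r.
by congr (f _ + f _ + f _ + f _); apply: val_inj.
Qed.

Lemma Psi_balance (R : pzRingType) (mu nu Pf0 Pf1 Pm0 Pm1 : R)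
    (p : 'cV[R]_4) :
  Psi mu nu Pf0 Pf1 Pm0 Pm1 *m p = p ->
  [/\ p S0 0 = Pf0 * (1 - mu) * p S0 0 + (1 - Pm0) * nu * p S1 0
               + Pf1 * (1 - mu) * p S2 0 + (1 - Pm1) * nu * p S3 0,
      p S1 0 = Pf0 * mu * p S0 0 + (1 - Pm0) * (1 - nu) * p S1 0
               + Pf1 * mu * p S2 0 + (1 - Pm1) * (1 - nu) * p S3 0,
      p S2 0 = (1 - Pf0) * (1 - mu) * p S0 0 + Pm0 * nu * p S1 0
               + (1 - Pf1) * (1 - mu) * p S2 0 + Pm1 * nu * p S3 0
    & p S3 0 = (1 - Pf0) * mu * p S0 0 + Pm0 * (1 - nu) * p S1 0
               + (1 - Pf1) * mu * p S2 0 + Pm1 * (1 - nu) * p S3 0].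
Proof.
move=> hp; split; by rewrite -{1}hp mxE sum_ord4 !mxE.
Qed.

(* The expression is affine in [zeta] and in [xi] separately; the proof
   interpolates between the endpoints 0 and 2 of their ranges. *)
Lemma collision_denominator_gt0 (R : realFieldType) (mu nu xi zeta : R) :
  0 < mu < 1 -> 0 < nu < 1 -> 0 < xi < 2 -> 0 < zeta < 2 ->
  0 < (mu - xi * (mu + nu - 1)) * zeta + xi * nu.
Proof.
move=> /andP[mu0 mu1] /andP[nu0 nu1] /andP[xi0 xi2] /andP[ze0 ze2].
have -> : (mu - xi * (mu + nu - 1)) * zeta + xi * nu =
    ((2 - zeta) * (xi * nu) + zeta * ((2 - xi) * mu + xi * (2 - nu - mu))) / 2.
  by field.
rewrite divr_gt0 // addr_gt0 // mulr_gt0 ?subr_gt0 ?mulr_gt0 //.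
by rewrite addr_gt0 // mulr_gt0 ?subr_gt0 //; lra.
Qed.

Theorem mainTheorem4 (R : realFieldType)
    (mu nu Pf0 Pf1 Pm0 Pm1 : R) (p : 'cV[R]_4)
    (hmu : 0 < mu < 1) (hnu : 0 < nu < 1)
    (hPf0 : 0 < Pf0 < 1) (hPf1 : 0 < Pf1 < 1)
    (hPm0 : 0 < Pm0 < 1) (hPm1 : 0 < Pm1 < 1)
    (hp : steady_state (Psi mu nu Pf0 Pf1 Pm0 Pm1) p) :
  let xi := 1 - Pf0 + Pf1 in
  let zeta := 1 + Pm0 - Pm1 in
  let r := nu / mu in
  let Delta := 1 + r - 1 / mu in
  collision_ratio mu nu p =
    nu / 2 + (Pm0 * (1 - xi * Delta) + (1 - Pf0) * r)
             / ((1 - xi * Delta) * zeta + xi * r).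
Proof.
move=> xi zeta r Delta.
case: hp => /Psi_balance[e0 _ e2 e3]; rewrite sum_ord4 => psum.
rewrite /collision_ratio /Pbusy.
move: (p S0 0) (p S1 0) (p S2 0) (p S3 0) e0 e2 e3 psum =>
  P0 P1 P2 P3 e0 e2 e3 psum.
have [mu0 nu0] : 0 < mu /\ 0 < nu by lra.
(* As [mu * Delta = mu + nu - 1], this is [mu] times the denominator of the formula. *)
have D0 : 0 < (mu - xi * (mu + nu - 1)) * zeta + xi * nu.
  by apply: collision_denominator_gt0 => //; rewrite /xi /zeta; lra.
have mun : mu != 0 by rewrite gt_eqF.
have sn : mu + nu != 0 by rewrite gt_eqF ?addr_gt0.
(* In [e0 + e2] the sensing probabilities cancel. *)
have PUbal : mu * (P0 + P2) = nu * (P1 + P3) by lra.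
have busy : P1 + P3 = mu / (mu + nu).
  apply: (mulIf sn); rewrite divfK //.
  have -> : (P1 + P3) * (mu + nu) = mu * (P1 + P3) + nu * (P1 + P3) by ring.
  by rewrite -PUbal -mulrDr -[RHS]mulr1 -psum; ring.
have idle : P0 + P2 = nu / (mu + nu).
  by apply: (mulfI mun); rewrite PUbal busy; field.
set F := (1 - Pf0) * (P0 + P2) + (1 - xi) * P2.
set G := Pm0 * (P1 + P3) + (1 - zeta) * P3.
have e2' : P2 = (1 - mu) * F + nu * G by rewrite {1}e2 /F /G /xi /zeta; ring.
have e3' : P3 = mu * F + (1 - nu) * G by rewrite {1}e3 /F /G /xi /zeta; ring.
(* [F] cancels in [mu * P2 - (1 - mu) * P3]. *)
have muP2 : mu * P2 = (1 - mu) * P3 + (mu + nu - 1) * G.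
  by rewrite {1}e2' {1}e3'; ring.
have hP3 : P3 * ((mu - xi * (mu + nu - 1)) * zeta + xi * nu) =
    mu * (1 - Pf0) * (P0 + P2) + Pm0 * (mu - xi * (mu + nu - 1)) * (P1 + P3).
  (* With [muP2], only [P3] and the marginals of the PU remain; collecting [P3] gives the claim. *)
  have : P3 = mu * (1 - Pf0) * (P0 + P2) + (1 - xi) * (mu * P2) + (1 - nu) * G.
    by rewrite {1}e3' /F; ring.
  by rewrite muP2 /G; lra.
(* The half-slot term over [mu / (mu + nu)] is the summand [nu / 2]. *)
rewrite busy.
have -> : P3 = (mu * (1 - Pf0) * (nu / (mu + nu))
     + Pm0 * (mu - xi * (mu + nu - 1)) * (mu / (mu + nu)))
     / ((mu - xi * (mu + nu - 1)) * zeta + xi * nu).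
  by rewrite -idle -busy -hP3 mulfK ?gt_eqF.
have DE : (1 - xi * Delta) * zeta + xi * r =
    ((mu - xi * (mu + nu - 1)) * zeta + xi * nu) / mu.
  by rewrite /Delta /r; field.
(* With [xi] and [zeta] opaque, the side condition on the denominator keeps the shape of [D0]. *)
rewrite DE /Delta /r; clearbody xi zeta; field.
by rewrite mun sn gt_eqF.
Qed.
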